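(* Let $X$ be a topological space. The closure $\overline{I}$, in the $m_B$-topology, of a proper ideal $I$ of $B_1(X)$ is also a proper ideal of $B_1(X)$.
   Context: A Baire one function on a topological space $X$ is a function $f:X\to\mathbb{R}$ that is the pointwise limit of a sequence of continuous real-valued functions on $X$. $B_1(X)$ is the commutative ring, under pointwise operations, of all Baire one functions on $X$. A positive unit of $B_1(X)$ is a unit $u$ of the ring $B_1(X)$ with $u(x)>0$ for all $x\in X$. The $m_B$-topology on $B_1(X)$ is the topology having as an open base the sets $\widetilde{M}(g,u)=\{f\in B_1(X): |f(x)-g(x)|<u(x)\text{ for every }x\in X\}$, where $g\in B_1(X)$ and $u$ is a positive unit of $B_1(X)$. *)

(* Defs.v *)
From HB Require Import structures.
From mathcomp Require Import all_boot all_order all_algebra.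
From mathcomp Require Import all_classical all_reals all_analysis.

Set Implicit Arguments.
Unset Strict Implicit.
Unset Printing Implicit Defensive.

Import Order.TTheory GRing.Theory Num.Theory.
Import numFieldNormedType.Exports.

Local Open Scope classical_set_scope.
Local Open Scope ring_scope.

Definition baire_one (R : realType) (X : topologicalType) (f : X -> R) : Prop :=
  exists F : nat -> X -> R,
    (forall n, continuous (F n)) /\ (forall x, F n x @[n --> \oo] --> f x).

Section CvgMinMax.
Context (R : realType) (T : Type) (F : set_system T) {FF : Filter F}.
Implicit Types (f g : T -> R) (a b : R).

Lemma cvg_minr f g a b : f x @[x --> F] --> a -> g x @[x --> F] --> b ->
  Num.min (f x) (g x) @[x --> F] --> Num.min a b.
Proof.
move=> fa gb; rewrite minr_absE; under eq_fun do rewrite minr_absE.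
apply: cvgM; last exact: cvg_cst.
by apply: cvgB; [exact: cvgD|apply: cvg_norm; exact: cvgB].
Qed.

Lemma cvg_maxr f g a b : f x @[x --> F] --> a -> g x @[x --> F] --> b ->
  Num.max (f x) (g x) @[x --> F] --> Num.max a b.
Proof.
move=> fa gb; rewrite maxr_absE; under eq_fun do rewrite maxr_absE.
apply: cvgM; last exact: cvg_cst.
by apply: cvgD; [exact: cvgD|apply: cvg_norm; exact: cvgB].
Qed.

End CvgMinMax.

Section BaireOneClosure.
Variables (R : realType) (X : topologicalType).
Implicit Types f g : X -> R.

Lemma baire_one_continuous f : continuous f -> baire_one f.
Proof. by move=> cf; exists (fun=> f); split=> // x; exact: cvg_cst. Qed.

Lemma baire_one_cst (c : R) : baire_one (fun _ : X => c).
Proof. by apply: baire_one_continuous => x; exact: cvg_cst. Qed.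

Lemma baire_oneB f g :
  baire_one f -> baire_one g -> baire_one (fun x => f x - g x).
Proof.
move=> [F [cF Ff]] [G [cG Gg]]; exists (fun n x => F n x - G n x).
by split=> [n x|x]; apply: cvgB; [exact: cF|exact: cG|exact: Ff|exact: Gg].
Qed.

Lemma baire_oneM f g :
  baire_one f -> baire_one g -> baire_one (fun x => f x * g x).
Proof.
move=> [F [cF Ff]] [G [cG Gg]]; exists (fun n x => F n x * G n x).
by split=> [n x|x]; apply: cvgM; [exact: cF|exact: cG|exact: Ff|exact: Gg].
Qed.

Lemma baire_one_norm f : baire_one f -> baire_one (fun x => `|f x|).
Proof.
move=> [F [cF Ff]]; exists (fun n x => `|F n x|).
by split=> [n x|x]; apply: cvg_norm; [exact: cF|exact: Ff].
Qed.

Lemma baire_one_min f g :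
  baire_one f -> baire_one g -> baire_one (fun x => Num.min (f x) (g x)).
Proof.
move=> [F [cF Ff]] [G [cG Gg]]; exists (fun n x => Num.min (F n x) (G n x)).
by split=> [n x|x]; apply: cvg_minr; [exact: cF|exact: cG|exact: Ff|exact: Gg].
Qed.

Lemma baire_oneV f :
  (forall x, 0 < f x) -> baire_one f -> baire_one (fun x => (f x)^-1).
Proof.
move=> f0 [F [cF Ff]].
exists (fun n x => (Num.max (F n x) (n.+1%:R^-1))^-1); split=> [n x|x].
  apply: cvgV; last by apply: cvg_maxr; [exact: cF|exact: cvg_cst].
  by rewrite gt_eqF// lt_max invr_gt0 ltr0n orbT.
apply: cvgV; first by rewrite gt_eqF.
rewrite -[f x](max_l (ltW (f0 x))).
by apply: cvg_maxr; [exact: Ff|exact: cvg_harmonic].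
Qed.

End BaireOneClosure.

Definition baire_one_pred (R : realType) (X : topologicalType) :
  {pred X -> R} := fun f => `[< baire_one f >].

Section BaireOneRing.
Variables (R : realType) (X : topologicalType).

Fact baire_one_subring_closed : subring_closed (@baire_one_pred R X).
Proof.
split; first by apply/asboolP; exact: baire_one_cst.
- by move=> f g /asboolP ? /asboolP ?; apply/asboolP; exact: baire_oneB.
- by move=> f g /asboolP ? /asboolP ?; apply/asboolP; exact: baire_oneM.
Qed.

HB.instance Definition _ :=
  GRing.isSubringClosed.Build (X -> R) (@baire_one_pred R X)
    baire_one_subring_closed.

Record B1 := MkB1 {
  B1_fun :> X -> R;
  B1_funP : B1_fun \in @baire_one_pred R X }.

HB.instance Definition _ := [isSub for B1_fun].
HB.instance Definition _ := [Choice of B1 by <:].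
(* B1 is the zero ring when X is empty, so it is not a comNzRingType. *)
HB.instance Definition _ :=
  GRing.SubChoice_isSubComPzRing.Build (X -> R) (@baire_one_pred R X) B1
    (subringClosedP _).

End BaireOneRing.
Arguments MkB1 {R X}.

(* Invertibility is spelled out because GRing.unit needs a nontrivial ring. *)
Definition invertible (A : comPzRingType) (u : A) : Prop :=
  exists v : A, u * v = 1.

Definition is_ideal (A : comPzRingType) (I : set A) : Prop :=
  [/\ I 0,
      forall a b, I a -> I b -> I (a + b) &
      forall r a, I a -> I (r * a)].

Definition is_proper_ideal (A : comPzRingType) (I : set A) : Prop :=
  is_ideal I /\ I != setT.

Section MBTopology.
Variables (R : realType) (X : topologicalType).
Implicit Types f g u : B1 R X.

Lemma B1_baire_one f : baire_one f.
Proof. exact/asboolP/(B1_funP f). Qed.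

Lemma B1_oneE (x : X) : (1 : B1 R X) x = 1. Proof. by []. Qed.

Lemma B1_mulE f g (x : X) : (f * g) x = f x * g x. Proof. by []. Qed.

Lemma B1_addE f g (x : X) : (f + g) x = f x + g x. Proof. by []. Qed.

Definition positive_unit u : Prop := invertible u /\ forall x, 0 < u x.

Definition mB_ball g u : set (B1 R X) :=
  [set f | forall x, `|f x - g x| < u x].

Definition mB_base : set (set (B1 R X)) :=
  [set A | exists g u, positive_unit u /\ A = mB_ball g u].

Lemma positive_unitP u : positive_unit u <-> forall x, 0 < u x.
Proof.
split=> [[]//|u0]; split=> //.
have Bv : (fun x => (u x)^-1) \in @baire_one_pred R X.
  by apply/asboolP; apply: baire_oneV => //; exact: B1_baire_one.
exists (MkB1 _ Bv); apply/val_inj/funext => x /=.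
by rewrite [LHS]divff// gt_eqF.
Qed.

Fact mB_base_cover : \bigcup_(A in mB_base) id A = setT.
Proof.
apply/seteqP; split=> // f _; exists (mB_ball f 1) => /=.
  by exists f, 1; split=> //; apply/positive_unitP => x; rewrite B1_oneE.
by move=> x; rewrite subrr normr0 B1_oneE.
Qed.

Fact mB_base_join (A B : set (B1 R X)) f :
  mB_base A -> mB_base B -> id A f -> id B f ->
  exists C, [/\ mB_base C, id C f & id C `<=` id A `&` id B].
Proof.
move=> [g [u [_ ->]]] [h [v [_ ->]]] /= gf hf.
pose w x := Num.min (u x - `|f x - g x|) (v x - `|f x - h x|).
have Bw : w \in @baire_one_pred R X.
  apply/asboolP; apply: baire_one_min; apply: baire_oneB;
    try (exact: B1_baire_one);
    by apply/baire_one_norm/baire_oneB; exact: B1_baire_one.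
have w0 x : 0 < w x by rewrite lt_min !subr_gt0 gf hf.
exists (mB_ball f (MkB1 w Bw)); split.
- by exists f, (MkB1 w Bw); split=> //; apply/positive_unitP.
- by move=> x /=; rewrite subrr normr0.
- move=> k fk; split=> x; have := fk x; rewrite /= lt_min => /andP[k1 k2].
  + rewrite -(subrKA (f x)) (le_lt_trans (ler_normD _ _))//.
    by rewrite -ltrBrDr.
  + rewrite -(subrKA (f x)) (le_lt_trans (ler_normD _ _))//.
    by rewrite -ltrBrDr.
Qed.

HB.instance Definition _ :=
  isBaseTopological.Build (B1 R X) mB_base_cover mB_base_join.

Lemma mB_openE (A : set (B1 R X)) :
  open A = (exists2 D, D `<=` mB_base & \bigcup_(B in D) B = A).
Proof. by []. Qed.

End MBTopology.

(* Main.v *)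
(* A function within 1/2 of the constant 1 is a positive unit, so a proper ideal
   has no element in the ball of radius 1/2 around 1, and 1 is not in its
   closure. *)
Require Import Defs.
From HB Require Import structures.
From mathcomp Require Import all_boot all_order all_algebra.
From mathcomp Require Import all_classical all_reals all_analysis.
From mathcomp Require Import lra.

Import Order.TTheory GRing.Theory Num.Theory.
Local Open Scope classical_set_scope.
Local Open Scope ring_scope.

(** Positive units are exactly the everywhere positive Baire one functions, so lying in the closure
    of [I] means being approximable from [I] within every such tolerance ([closure_mBP]). Sums and
    multiples of approximable functions are approximable, since the tolerance may be halved or
    divided by a positive Baire one function ([closure_ideal]). If 1 were in the closure, some [g]
    in [I] would be everywhere positive, hence invertible, and [I] would be the whole ring
    ([ideal_invertible]). *)

Lemma baire_oneD (R : realType) (X : topologicalType) (f g : X -> R) :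
  baire_one f -> baire_one g -> baire_one (fun x => f x + g x).
Proof.
move=> Bf Bg; have -> : (fun x => f x + g x) = (fun x => f x - (0 - g x)).
  by apply/funext => x; rewrite sub0r opprK.
by apply: baire_oneB => //; apply: baire_oneB => //; exact: baire_one_cst.
Qed.

Lemma ideal_invertible (A : comPzRingType) (I : set A) (u : A) :
  is_ideal I -> I u -> invertible u -> I = setT.
Proof.
move=> [_ _ IM] Iu [v uv]; apply/seteqP; split=> // a _.
by rewrite -[a]mulr1 -uv (mulrC u) mulrA; exact: IM.
Qed.

Section MBClosure.
Context {R : realType} {X : topologicalType}.
Implicit Types (f g u : B1 R X) (w : X -> R) (I : set (B1 R X)).

Lemma mB_ball_open g u : positive_unit u -> open (mB_ball g u).
Proof.
move=> u0; rewrite mB_openE; exists [set mB_ball g u].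
  by move=> _ ->; exists g, u.
by rewrite bigcup_set1.
Qed.

(** Balls centred at [f] form a neighbourhood base at [f]: a basic ball containing [f] but centred
    elsewhere contains a smaller ball around [f]. *)
Lemma closure_mBP I f :
  closure I f <->
  forall w, baire_one w -> (forall x, 0 < w x) ->
    exists2 g, I g & forall x, `|g x - f x| < w x.
Proof.
split=> [If w Bw w0|If B].
  have Pw : w \in @baire_one_pred R X by exact/asboolP.
  have : nbhs f (mB_ball f (MkB1 w Pw)).
    apply: open_nbhs_nbhs; split; first exact/mB_ball_open/positive_unitP.
    by move=> x; rewrite subrr normr0; exact: w0.
  by move=> /If[g [Ig fg]]; exists g.
rewrite nbhsE => -[U [oU Uf] UB].
move: oU Uf UB; rewrite mB_openE => -[D Dbase <-] [C DC Cf] UB.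
have [h [v [_ eC]]] := Dbase _ DC.
move: Cf; rewrite eC => hf.
(* The tolerance is the room left around [f] inside the ball of centre [h] and radius [v]; the
   triangle inequality then puts [g] in that ball. *)
have [||g Ig fg] := If (fun x => v x - `|f x - h x|).
- apply: baire_oneB; first exact: B1_baire_one.
  by apply/baire_one_norm/baire_oneB; exact: B1_baire_one.
- by move=> x; rewrite subr_gt0; exact: hf.
exists g; split=> //; apply: UB; exists C => //; rewrite eC => x.
rewrite -(subrKA (f x)) (le_lt_trans (ler_normD _ _))//.
by rewrite -ltrBrDr.
Qed.

Lemma closure_ideal I : is_ideal I -> is_ideal (closure I).
Proof.
move=> [I0 ID IM]; split; first exact: subset_closure.
- move=> a b /closure_mBP Ia /closure_mBP Ib; apply/closure_mBP => w Bw w0.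
  have Bw2 : baire_one (fun x => w x * 2^-1).
    by apply: baire_oneM => //; exact: baire_one_cst.
  have w20 x : 0 < w x * 2^-1 by rewrite divr_gt0.
  have [a' Ia' aa'] := Ia _ Bw2 w20.
  have [b' Ib' bb'] := Ib _ Bw2 w20.
  exists (a' + b'); first exact: ID.
  move=> x; rewrite !B1_addE opprD addrACA (le_lt_trans (ler_normD _ _))//.
  by rewrite [ltRHS]splitr ltrD.
- move=> r a /closure_mBP Ia; apply/closure_mBP => w Bw w0.
  (* The summand 1 keeps the divisor positive where [r] vanishes, and the divisor still dominates
     [|r x|]. *)
  have r0 x : 0 < 1 + `|r x| by rewrite ltr_pwDl.
  have [||a' Ia' aa'] := Ia (fun x => w x * (1 + `|r x|)^-1).
  + apply: baire_oneM => //; apply: baire_oneV => //.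
    apply: baire_oneD; first exact: baire_one_cst.
    by apply: baire_one_norm; exact: B1_baire_one.
  + by move=> x; rewrite divr_gt0.
  exists (r * a'); first exact: IM.
  move=> x; rewrite !B1_mulE -mulrBr normrM.
  have := aa' x; rewrite ltr_pdivlMr// mulrC; apply: le_lt_trans.
  by rewrite ler_wpM2r// lerDr.
Qed.

End MBClosure.

Theorem theorem2p13 (R : realType) (X : topologicalType) (I : set (B1 R X)) :
  is_proper_ideal I -> is_proper_ideal (closure I).
Proof.
move=> [idI /eqP IT]; split; first exact: closure_ideal.
apply/eqP => cT; apply: IT.
have /closure_mBP I1 : closure I 1 by rewrite cT.
(* The constant tolerance 1/2 forces [g x > 1/2] at every point. *)
have [|//|g Ig g1] := I1 (fun=> 2^-1); first exact: baire_one_cst.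
have [gu _] : positive_unit g.
  apply/positive_unitP => x.
  by have := g1 x; rewrite B1_oneE ltr_norml => /andP[? _]; lra.
exact: ideal_invertible gu.
Qed.
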